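(* Let $n\ge 1$ be an integer, $\sigma_{\mathrm{in}},\sigma_{\mathrm{out}}>0$, and consider the two-parameter Gaussian experiment with unknown $(\theta_1,\theta_2)\in\mathbb{R}^2$ and observations $$\bar y_{\mathrm{in}}=(n+1)^{-1}(\theta_1+\theta_2)+\bar w_{\mathrm{in}},\qquad \bar y_{\mathrm{out}}=n^{-1}\theta_2+\bar w_{\mathrm{out}},$$ where $\bar w_{\mathrm{in}}\sim\mathcal N(0,\sigma_{\mathrm{in}}^2/L_{\mathrm{in}})$ and $\bar w_{\mathrm{out}}\sim\mathcal N(0,\sigma_{\mathrm{out}}^2/L_{\mathrm{out}})$ are independent and $L_{\mathrm{in}},L_{\mathrm{out}}\ge 1$. Then the minimum achievable mean squared error for unbiased estimation of $\theta_1=x_j$ is $$\mathrm{MSE}^*(x_j)=\frac{(n+1)^2\sigma_{\mathrm{in}}^2}{L_{\mathrm{in}}}+\frac{n^2\sigma_{\mathrm{out}}^2}{L_{\mathrm{out}}},$$ and it is attained by the best linear unbiased estimator $$\hat x_j=(n+1)\bar y_{\mathrm{in}}-n\bar y_{\mathrm{out}}.$$ For the continuous relaxation $L_{\mathrm{in}},L_{\mathrm{out}}>0$, $L_{\mathrm{in}}+L_{\mathrm{out}}=L$ (with $L$ fixed), the optimal split, i.e. the one minimizing $\mathrm{MSE}^*(x_j)$, satisfies $$\frac{L_{\mathrm{in}}}{L_{\mathrm{out}}}=\frac{n+1}{n}\,\frac{\sigma_{\mathrm{in}}}{\sigma_{\mathrm{out}}},$$ with minimized value $$\min_{\substack{L_{\mathrm{in}},L_{\mathrm{out}}>0\\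 L_{\mathrm{in}}+L_{\mathrm{out}}=L}}\mathrm{MSE}^*(x_j)=L^{-1}\bigl((n+1)\sigma_{\mathrm{in}}+n\sigma_{\mathrm{out}}\bigr)^2.$$ If release counts are required to be integers, the optimal integer split is obtained by the nearest feasible rounding around this continuous ratio.
   Context: Origin of the experiment: scalar records $x_1,\dots,x_N$, a target index $j$, and a background set $B\subseteq\{1,\dots,N\}\setminus\{j\}$ with $|B|=n$. In total $L=L_{\mathrm{in}}+L_{\mathrm{out}}$ noisy answers are released: $L_{\mathrm{in}}$ independently perturbed copies of $q_{\mathrm{in}}=(n+1)^{-1}(x_j+\sum_{k\in B}x_k)$ with Gaussian noise of variance $\sigma_{\mathrm{in}}^2$, and $L_{\mathrm{out}}$ independently perturbed copies of $q_{\mathrm{out}}=n^{-1}\sum_{k\in B}x_k$ with Gaussian noise of variance $\sigma_{\mathrm{out}}^2$. The quantities $\bar y_{\mathrm{in}},\bar y_{\mathrm{out}}$ are the empirical means of the two blocks, $\theta_1=x_j$ is the target, and $\theta_2=\sum_{k\in B}x_k$ is a nuisance parameter. ''Unbiased'' means unbiased for every $(\theta_1,\theta_2)\in\mathbb{R}^2$.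
   Formalization: ''Nearest feasible rounding'' is read as: L_in rounded down or up (kept within 1..L-1), whichever gives the ratio L_in/L_out nearest to the continuous ratio on a logarithmic scale; with ordinary distance on L_in or on the ratio the claim is false. *)

(* Defs.v *)
From HB Require Import structures.
From mathcomp Require Import all_boot all_order all_algebra.
From mathcomp Require Import all_classical all_reals all_analysis.

Set Implicit Arguments.
Unset Strict Implicit.
Unset Printing Implicit Defensive.

Import Order.TTheory GRing.Theory Num.Theory.
Import numFieldNormedType.Exports.

Local Open Scope classical_set_scope.
Local Open Scope ring_scope.

(* The second argument of [normal_prob] is a standard deviation. *)
Definition gaussian_rv d (Omega : measurableType d) (R : realType)
    (P : probability Omega R) (w : {RV P >-> R}) (m v : R) : Prop :=
  forall A : set R, measurable A ->
    distribution P w A = normal_prob m (Num.sqrt v) A.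

Definition independent_rvs d (Omega : measurableType d) (R : realType)
    (P : probability Omega R) (X Y : {RV P >-> R}) : Prop :=
  forall A B : set R, measurable A -> measurable B ->
    P ((X @^-1` A) `&` (Y @^-1` B)) = (P (X @^-1` A) * P (Y @^-1` B))%E.

(* The parameter is [theta = (theta1, theta2)]; the result is the pair of
   block means (in, out). *)
Definition observations (Omega : Type) (R : realType) (n : nat)
    (win wout : Omega -> R) (theta : R * R) (omega : Omega) : R * R :=
  (n.+1%:R^-1 * (theta.1 + theta.2) + win omega,
   n%:R^-1 * theta.2 + wout omega).

Section estimation.
Context d (Omega : measurableType d) (R : realType) (P : probability Omega R).
Context (Y : R * R -> Omega -> R * R).

(* Unbiasedness for the first coordinate, at every parameter; the mean is
   required to exist, but no second moment is assumed. *)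
Definition unbiased (T : R * R -> R) : Prop :=
  measurable_fun setT T /\
  forall theta : R * R,
    P.-integrable setT (EFin \o (T \o Y theta)) /\
    ('E_P[T \o Y theta] = theta.1%:E)%E.

(* [+oo] when [T] has no second moment at [theta]. *)
Definition mse (T : R * R -> R) (theta : R * R) : \bar R :=
  ('E_P[fun omega => ((T (Y theta omega) - theta.1) ^+ 2)%R])%E.

Definition linear_estimator (T : R * R -> R) : Prop :=
  exists a b : R, forall y : R * R, T y = a * y.1 + b * y.2.

Definition best_linear_unbiased (T : R * R -> R) : Prop :=
  [/\ linear_estimator T, unbiased T &
      forall T' : R * R -> R, linear_estimator T' -> unbiased T' ->
      forall theta : R * R, (mse T theta <= mse T' theta)%E].

(* [v] is the minimum, over all unbiased estimators, of the mean squared error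
   at [theta]. *)
Definition is_minimum_mse (theta : R * R) (v : \bar R) : Prop :=
  (exists T : R * R -> R, unbiased T /\ mse T theta = v) /\
  (forall T : R * R -> R, unbiased T -> (v <= mse T theta)%E).

End estimation.

Definition x_hat (R : realType) (n : nat) (y : R * R) : R :=
  n.+1%:R * y.1 - n%:R * y.2.

(* The counts are real, so that the same expression serves the experiment
   (integer counts) and the continuous relaxation. *)
Definition mse_star (R : realType) (n : nat) (s_in s_out Lin Lout : R) : R :=
  n.+1%:R ^+ 2 * s_in ^+ 2 / Lin + n%:R ^+ 2 * s_out ^+ 2 / Lout.

Section splits.
Context (R : realType) (n : nat) (s_in s_out : R).

Definition feasible_split (L Lin Lout : R) : Prop :=
  [/\ 0 < Lin, 0 < Lout & Lin + Lout = L].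

Definition optimal_split (L Lin Lout : R) : Prop :=
  feasible_split L Lin Lout /\
  forall Lin' Lout' : R, feasible_split L Lin' Lout' ->
    mse_star n s_in s_out Lin Lout <= mse_star n s_in s_out Lin' Lout'.

Definition ratio_star : R := n.+1%:R / n%:R * (s_in / s_out).

Definition feasible_isplit (L kin kout : nat) : Prop :=
  [/\ (1 <= kin)%N, (1 <= kout)%N & (kin + kout)%N = L].

Definition optimal_isplit (L kin kout : nat) : Prop :=
  feasible_isplit L kin kout /\
  forall kin' kout' : nat, feasible_isplit L kin' kout' ->
    mse_star n s_in s_out kin%:R kout%:R <= mse_star n s_in s_out kin'%:R kout'%:R.

(* The [Lin] with [Lin / (L - Lin) = ratio_star]. *)
Definition Lin_star (L : nat) : R := L%:R * (ratio_star / (1 + ratio_star)).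

(* [kin] is [Lin_star L] rounded down or up to an integer, then moved into the
   feasible range [1 .. L - 1] if necessary. *)
Definition feasible_rounding (L kin kout : nat) : Prop :=
  feasible_isplit L kin kout /\
  (kin = maxn 1 (Num.truncn (Lin_star L)) \/
   kin = minn L.-1 `|Num.ceil (Lin_star L)|%N).

(* Ratios are positive quantities and are compared multiplicatively. With the
   additive distance on ratios, or the distance |kin - Lin_star L|, the nearest
   rounding need not be optimal: for L = 4 and weights (n+1) s_in : n s_out equal
   to 37 : 63 one has Lin_star = 1.48, but kin = 2 beats kin = 1. *)
Definition ratio_dist (kin kout : nat) : R :=
  `|ln (kin%:R / kout%:R) - ln ratio_star|.

Definition nearest_feasible_rounding (L kin kout : nat) : Prop :=
  feasible_rounding L kin kout /\
  forall kin' kout' : nat, feasible_rounding L kin' kout' ->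
    ratio_dist kin kout <= ratio_dist kin' kout'.

End splits.

(* Main.v *)
(* Lower bound.  The Hammersley-Chapman-Robbins inequality, with the likelihood
   ratio rho_t = exp(t U - t^2 v / 2), where U = (n+1) w_in - n w_out and
   v = Var U.  By Cameron-Martin, multiplying by rho_t amounts to shifting the
   noise by t Cov(w, U), which is the effect of a change of parameter that moves
   theta1 by t v.  So an unbiased estimator with centred value g has
   E[g rho_t] = t v, and integrating
     2 t^-1 g (rho_t - 1) <= g^2 + t^-2 (rho_t - 1)^2
   yields 2 v <= E[g^2] + (e^(t^2 v) - 1) / t^2; let t tend to 0.
   The estimator x_hat has error exactly U, whose first two moments are read off
   from E[e^(t U)] = e^(t^2 v / 2), again as t tends to 0.

   Splits.  With a = (n+1) s_in and b = n s_out, a^2/x + b^2/y exceeds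
   (a+b)^2/(x+y) by a multiple of (a y - b x)^2.  Passing from k to k+1 in
   the integer problem does not lower the cost iff the squared ratio (a/b)^2 is at
   most the product of the ratios k/(L-k) and (k+1)/(L-k-1), that is, iff the
   first of these is no farther from a/b on the logarithmic scale. *)
Require Import Defs.
From HB Require Import structures.
From mathcomp Require Import all_boot all_order all_algebra.
From mathcomp Require Import all_classical all_reals all_analysis.
From mathcomp Require Import measurable_realfun.
From mathcomp Require Import ring lra zify.

Set Implicit Arguments.
Unset Strict Implicit.
Unset Printing Implicit Defensive.

Import Order.TTheory GRing.Theory Num.Theory.
Import numFieldNormedType.Exports.

Local Open Scope classical_set_scope.
Local Open Scope ring_scope.

(** * Integration against a measure given by a density *)

Section density.
Local Open Scope ereal_scope.
Context d (T : measurableType d) (R : realType).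
Variables (mu nu : {measure set T -> \bar R}) (h : T -> R).
Hypotheses (mh : measurable_fun setT h) (h0 : forall x, (0 <= h x)%R).
Hypothesis nuE : forall A, measurable A -> nu A = \int[mu]_(x in A) (h x)%:E.

Import HBNNSimple.

(** [nuE] is the case of indicators; linearity extends it to nonnegative simple functions, and
    monotone convergence along [nnsfun_approx] to [f]. *)
Lemma ge0_integral_density (f : T -> \bar R) :
  measurable_fun setT f -> (forall x, 0 <= f x) ->
  \int[nu]_x f x = \int[mu]_x (f x * (h x)%:E).
Proof.
move=> mf f0; pose f_ := nnsfun_approx measurableT mf.
have f_cvg x : (f_ n x)%:E @[n --> \oo] --> f x.
  by apply: cvg_nnsfun_approx.
have f_nd x : {homo (fun n => f_ n x) : m k / (m <= k)%N >-> (m <= k)%R}.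
  by move=> m k mk; exact/lefP/nd_nnsfun_approx.
transitivity (limn (fun n => \int[nu]_x (f_ n x)%:E)).
  rewrite -monotone_convergence//.
  - by apply: eq_integral => x _; apply/esym/cvg_lim.
  - by move=> n; exact/measurable_EFinP/measurable_funP.
  - by move=> n x _; rewrite lee_fin.
  - by move=> x _ m n mn; rewrite lee_fin; exact: f_nd.
have -> : \int[mu]_x (f x * (h x)%:E) =
    limn (fun n => \int[mu]_x ((f_ n x)%:E * (h x)%:E)).
  rewrite -monotone_convergence//.
  - apply: eq_integral => x _; apply/esym/cvg_lim => //.
    by apply: cvgeZr => //; exact: f_cvg.
  - move=> n; apply: emeasurable_funM; exact/measurable_EFinP.
  - by move=> n x _; rewrite -EFinM lee_fin mulr_ge0.
  - by move=> x _ m n mn; rewrite -!EFinM lee_fin ler_wpM2r//; exact: f_nd.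
congr (limn _); apply/funext => n.
under eq_integral do rewrite fimfunE -fsumEFin//.
rewrite ge0_integral_fsum//; last 2 first.
- by move=> r /=; apply: measurableT_comp => //; exact: measurableT_comp.
- by move=> r t _; rewrite EFinM nnfun_muleindic_ge0.
under [in RHS]eq_integral.
  move=> x _; rewrite fimfunE -fsumEFin// ge0_mule_fsuml; last first.
    by move=> r; rewrite EFinM nnfun_muleindic_ge0.
  over.
rewrite ge0_integral_fsum//; last 2 first.
- move=> r /=; apply: emeasurable_funM; apply/measurable_EFinP => //.
  exact: measurable_funM.
- move=> r t _; apply: mule_ge0; last by rewrite lee_fin.
  by rewrite EFinM nnfun_muleindic_ge0.
apply: eq_fsbigr => r _ /=.
rewrite integralZl_indic_nnsfun// integral_indic// setIT nuE; last first.
  exact: measurable_funPTI.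
(* The finite sum runs over real [r]; a negative [r] has empty preimage under a nonnegative simple
   function, so both of its terms are 0. *)
have [r0|r0] := leP 0%R r; last first.
  rewrite preimage_nnfun0// integral_set0 mule0.
  by rewrite integral0_eq// => x _; rewrite indic0 mulr0 mul0e.
under [in RHS]eq_integral do rewrite EFinM -muleA.
rewrite ge0_integralZl//.
- rewrite integral_mkcond; congr (_ * _); apply: eq_integral => x _.
  by rewrite /patch indicE; case: ifPn => _; rewrite ?mul1e ?mul0e.
- by apply: emeasurable_funM => //; apply/measurable_EFinP.
- by move=> x _; rewrite mule_ge0 ?lee_fin.
Qed.

End density.

(** * Translations of Lebesgue and Gaussian integrals *)

(** The translated measure gives half-open intervals their length, and this determines Lebesgue
    measure. *)
Lemma lebesgue_measureD (R : realType) (c : R) (A : set R) : measurable A ->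
  pushforward lebesgue_measure
    ((fun x => x + c) : measurableTypeR R -> measurableTypeR R) A =
  lebesgue_measure A.
Proof.
move=> mA.
have mc : measurable_fun setT
    ((fun x => x + c) : measurableTypeR R -> measurableTypeR R).
  exact: measurable_funD.
apply/esym/(@lebesgue_measure_unique _ (pushforward lebesgue_measure _)) => //=.
move=> _ [[a b]] _ <-.
rewrite /pushforward.
rewrite (_ : _ @^-1` _ = `]a - c, b - c]%classic); last first.
  by apply/seteqP; split => x /=; rewrite !in_itv/= ltrBlDr lerBrDr.
rewrite !lebesgue_measure_itv/= !lte_fin ltrD2r.
by case: ifPn => // _; congr EFin; ring.
Qed.

Lemma ge0_integral_lebesgueD (R : realType) (c : R) (f : R -> \bar R) :
  measurable_fun setT f -> (forall x, 0 <= f x)%E ->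
  (\int[lebesgue_measure]_x f (x + c)%R = \int[lebesgue_measure]_x f x)%E.
Proof.
move=> mf f0.
have mc : measurable_fun setT
    ((fun x => x + c) : measurableTypeR R -> measurableTypeR R).
  exact: measurable_funD.
transitivity (\int[pushforward lebesgue_measure
   ((fun x => (x + c)%R) : measurableTypeR R -> measurableTypeR R)]_x f x)%E.
  by rewrite ge0_integral_pushforward.
by apply: eq_measure_integral => A mA _; exact: lebesgue_measureD.
Qed.

Lemma ge0_integral_normal_prob (R : realType) (m s : R) (f : R -> \bar R) :
  measurable_fun setT f -> (forall x, 0 <= f x)%E ->
  (\int[normal_prob m s]_x f x =
   \int[lebesgue_measure]_x (f x * (normal_pdf m s x)%:E))%E.
Proof.
move=> mf f0; apply: ge0_integral_density => //.
- exact: measurable_normal_pdf.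
- by move=> x; exact: normal_pdf_ge0.
Qed.

(** Expanding the square in the exponent leaves the one-dimensional Cameron-Martin factor. *)
Lemma normal_pdf_shift (R : realType) (v c x : R) : 0 < v ->
  normal_pdf 0 (Num.sqrt v) (x - c) =
  normal_pdf 0 (Num.sqrt v) x * expR ((c * x - c ^+ 2 / 2) / v).
Proof.
move=> v0; have s0 : Num.sqrt v != 0 by rewrite gt_eqF// sqrtr_gt0.
rewrite !normal_pdfE//= -mulrA; congr (_ * _).
rewrite /normal_fun -expRD sqr_sqrtr ?ltW//; congr expR.
by field; rewrite gt_eqF.
Qed.

Lemma ge0_integral_normal_shift (R : realType) (v c : R) (f : R -> \bar R) :
  0 < v -> measurable_fun setT f -> (forall x, 0 <= f x)%E ->
  (\int[normal_prob 0%R (Num.sqrt v)]_x f (x + c)%R =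
   \int[normal_prob 0%R (Num.sqrt v)]_x
     (f x * (expR ((c * x - c ^+ 2 / 2) / v))%:E))%E.
Proof.
move=> v0 mf f0.
have mshift (a : R) : measurable_fun setT (fun x : R => x + a).
  exact: measurable_funD.
rewrite !ge0_integral_normal_prob//; last 3 first.
- apply: emeasurable_funM => //; apply/measurable_EFinP.
  apply: measurableT_comp => //; apply: measurable_funM => //.
  by apply: measurable_funB => //; exact: measurable_funM.
- by move=> x; rewrite mule_ge0// lee_fin expR_ge0.
- exact: measurableT_comp.
(* Writing [x] as [(x + c) - c] in the density makes the whole integrand a function of [x + c],
   ready for translation. *)
transitivity (\int[lebesgue_measure]_x
    (f (x + c)%R * (normal_pdf 0 (Num.sqrt v) ((x + c) - c))%:E))%E.
  by apply: eq_integral => x _; rewrite addrK.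
rewrite (@ge0_integral_lebesgueD _ c
  (fun x => f x * (normal_pdf 0 (Num.sqrt v) (x - c))%:E)%E).
- by apply: eq_integral => x _; rewrite normal_pdf_shift// muleAC -muleA -EFinM.
- apply: emeasurable_funM => //; apply/measurable_EFinP.
  by apply: (measurableT_comp (measurable_normal_pdf _ _)); exact: mshift.
- by move=> x; rewrite mule_ge0// lee_fin normal_pdf_ge0.
Qed.

(** * Independent Gaussian pairs and the two-dimensional Cameron-Martin formula *)

Section gaussian_pair.
Context d (Omega : measurableType d) (R : realType) (P : probability Omega R).
Variables (X Y : {RV P >-> R}) (vx vy : R).
Hypotheses (vx0 : 0 < vx) (vy0 : 0 < vy).
Hypotheses (gX : gaussian_rv X 0 vx) (gY : gaussian_rv Y 0 vy).
Hypothesis XY : independent_rvs X Y.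

Local Notation NX := (normal_prob (0 : R) (Num.sqrt vx)).
Local Notation NY := (normal_prob (0 : R) (Num.sqrt vy)).

Local Open Scope ereal_scope.

(** Independence identifies the joint law with the product measure on rectangles, hence everywhere;
    Tonelli then gives the iterated integral. *)
Lemma ge0_integral_gaussian_pair (f : R * R -> \bar R) :
  measurable_fun setT f -> (forall x, 0 <= f x) ->
  \int[P]_w f (X w, Y w) = \int[NX]_x \int[NY]_y f (x, y).
Proof.
move=> mf f0.
have mXY : measurable_fun setT
    ((fun w => (X w, Y w)) : Omega -> measurableTypeR R * measurableTypeR R).
  apply: measurable_fun_pair; first exact: (measurable_funPT X).
  exact: (measurable_funPT Y).
transitivity (\int[pushforward P ((fun w => (X w, Y w)) :
    Omega -> measurableTypeR R * measurableTypeR R)]_z f z).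
  by rewrite ge0_integral_pushforward.
transitivity (\int[NX \x NY]_z f z); last by rewrite fubini_tonelli1.
apply: eq_measure_integral => A mA _; apply/esym.
apply: (@product_measure_unique _ _ _ _ _ NX NY
  (pushforward P ((fun w => (X w, Y w)) :
    Omega -> measurableTypeR R * measurableTypeR R))) => // B C mB mC.
transitivity (distribution P X B * distribution P Y C); first exact: XY.
by congr (_ * _); [exact: gX|exact: gY].
Qed.

Lemma ge0_integral_gaussian_pair_shift (cx cy : R) (f : R * R -> \bar R) :
  measurable_fun setT f -> (forall x, 0 <= f x) ->
  \int[P]_w f (X w + cx, Y w + cy)%R =
  \int[P]_w (f (X w, Y w) *
    (expR ((cx * X w - cx ^+ 2 / 2) / vx + (cy * Y w - cy ^+ 2 / 2) / vy))%:E).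
Proof.
move=> mf f0.
pose e (c v x : R) : R := expR ((c * x - c ^+ 2 / 2) / v).
have me c v : measurable_fun setT (e c v).
  apply: measurableT_comp => //; apply: measurable_funM => //.
  by apply: measurable_funB => //; exact: measurable_funM.
have e0 c v x : 0 <= (e c v x)%:E by rewrite lee_fin expR_ge0.
have mp1 x : measurable_fun setT (fun y : R => (x, y) : R * R).
  exact: pair1_measurable.
have mshift : measurable_fun setT
    (fun z : R * R => (z.1 + cx, z.2 + cy)%R : R * R).
  by apply: measurable_fun_pair; apply: measurable_funD.
rewrite [LHS](@ge0_integral_gaussian_pair
    (fun z => f (z.1 + cx, z.2 + cy)%R))//;
  last first.
  exact: (measurableT_comp mf).
under [RHS]eq_integral do rewrite expRD EFinM.
pose g (z : R * R) := f z * ((e cx vx z.1)%:E * (e cy vy z.2)%:E).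
have mg : measurable_fun setT g.
  apply: emeasurable_funM => //; apply: emeasurable_funM.
    by apply/measurable_EFinP; exact: (measurableT_comp (me _ _)).
  by apply/measurable_EFinP; exact: (measurableT_comp (me _ _)).
rewrite [RHS](@ge0_integral_gaussian_pair g)//; last first.
  by move=> z; rewrite !mule_ge0.
(* One coordinate is shifted at a time: [F] is the inner integral once the shift in [y] has been
   traded for its factor, and it is then shifted in [x]. *)
pose F x := \int[NY]_y (f (x, y) * (e cy vy y)%:E).
have mfe : measurable_fun setT (fun z : R * R => f z * (e cy vy z.2)%:E).
  by apply: emeasurable_funM => //; apply/measurable_EFinP;
     exact: (measurableT_comp (me _ _)).
have fe0 z : 0 <= f z * (e cy vy z.2)%:E by rewrite mule_ge0.
transitivity (\int[NX]_x F (x + cx)%R).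
  apply: eq_integral => x _ /=.
  rewrite (@ge0_integral_normal_shift _ vy cy (fun y => f (x + cx, y)%R))//.
  exact: (measurableT_comp mf).
have mF : measurable_fun setT F.
  exact: (measurable_fun_fubini_tonelli_F
    (fun z : measurableTypeR R * measurableTypeR R => f z * (e cy vy z.2)%:E)).
have F0 x : 0 <= F x by apply: integral_ge0 => y _; exact: (fe0 (x, y)).
rewrite [LHS](ge0_integral_normal_shift cx vx0 mF F0).
apply: eq_integral => x _; rewrite /F -ge0_integralZr//.
- by apply: eq_integral => y _; rewrite /g/= muleAC muleA.
- exact: (measurableT_comp mfe (mp1 x)).
Qed.

End gaussian_pair.

(** * Exponential inequalities and an elementary limit *)

(** The difference of the two sides vanishes at 0 and has derivative [expR x + expR (- x) - 2],
    which is nonnegative. *)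
Lemma sinh_ge (R : realType) (h : R) : 0 <= h -> h *+ 2 <= expR h - expR (- h).
Proof.
move=> h0.
pose f (x : R) : R := expR x - expR (- x) - 2 * x.
have df (x : R) : is_derive x 1 f (expR x + expR (- x) - 2).
  by apply: is_derive_eq; rewrite !scaler1 mulrN1 opprK.
have [c _ fE] : exists2 c, c \in `[0, h]%R &
    f h - f 0 = (expR c + expR (- c) - 2) * (h - 0).
  apply: MVT_segment => //.
  apply: continuous_subspaceT => x.
  by apply: differentiable_continuous; apply/derivable1_diffP; case: (df x).
have : 0 <= f h - f 0.
  rewrite fE subr0 mulr_ge0//.
  have := expR_ge1Dx c; have := expR_ge1Dx (- c); lra.
rewrite /f oppr0 expR0; lra.
Qed.

(** By evenness [0 <= y]; then square [sinh_ge] at [y / 2]. It serves to bound second moments by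
    exponential ones. *)
Lemma cosh_ge (R : realType) (y : R) : 2 + y ^+ 2 <= expR y + expR (- y).
Proof.
wlog y0 : y / 0 <= y => [hw|].
  have [/hw//|/ltW y0] := leP 0 y.
  have := hw (- y); rewrite oppr_ge0 opprK sqrrN => /(_ y0).
  by rewrite [_ + expR y]addrC.
have h0 : 0 <= y / 2 by rewrite divr_ge0.
have e1 : expR y = expR (y / 2) ^+ 2 by rewrite expr2 -expRD -splitr.
have e2 : expR (- y) = expR (- (y / 2)) ^+ 2.
  by rewrite expr2 -expRD -opprD -splitr.
have e3 : expR (y / 2) * expR (- (y / 2)) = 1 by rewrite -expRD subrr expR0.
have := sinh_ge h0; rewrite e1 e2.
move: e3; set a := expR (y / 2); set b := expR (- (y / 2)) => ab1 hab.
have : y ^+ 2 <= (a - b) ^+ 2 by rewrite ler_sqr ?nnegrE//; lra.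
rewrite sqrrB ab1; lra.
Qed.

(** [expR x <= 1 / (1 - x)], and [(1 + x + 2 x^2) (1 - x) = 1 + x^2 (1 - 2 x)] is at least 1 on this
    range. *)
Lemma expR_le_quadratic (R : realType) (x : R) :
  0 <= x -> x <= 1 / 2 -> expR x <= 1 + x + 2 * x ^+ 2.
Proof.
move=> x0 x1.
have h1 : expR (- x) >= 1 - x by exact: expR_ge1Dx.
have h2 : expR x * expR (- x) = 1 by rewrite -expRD subrr expR0.
have h3 := expR_ge0 x.
have h4 : expR x * (1 - x) <= 1 by have := ler_wpM2l h3 h1; rewrite h2.
nra.
Qed.

(** This carries out every passage to the limit as [t] tends to 0 below. *)
Lemma ler_lim_linear (R : realFieldType) (A B K e : R) : 0 < e -> 0 <= K ->
  (forall t, 0 < t -> t <= e -> A <= B + K * t) -> A <= B.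
Proof.
move=> e0 K0 AB; apply/ler_addgt0Pr => u u0.
have K1 : 0 < K + 1 by rewrite ltr_wpDl.
pose t := Num.min e (u / (K + 1)).
have t0 : 0 < t by rewrite lt_min e0 divr_gt0.
have te : t <= e by rewrite ge_min lexx.
have tu : t * (K + 1) <= u by rewrite -ler_pdivlMr// ge_min lexx orbT.
apply: (le_trans (AB t t0 te)); rewrite lerD2l.
by apply: le_trans tu; nra.
Qed.

(** * Calculus of finite means *)

Section has_mean.
Context d (T : measurableType d) (R : realType) (P : probability T R).
Implicit Types (X Y : T -> R) (m : R).

(** Integrability is bundled with the value, so that linear combinations of means carry no side
    conditions. *)
Definition has_mean X m : Prop :=
  P.-integrable setT (EFin \o X) /\ (\int[P]_w (X w)%:E = m%:E)%E.

Lemma has_mean_cst m : has_mean (fun=> m) m.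
Proof.
split; first exact: (finite_measure_integrable_cst P).
by rewrite -[RHS](expectation_cst P) unlock.
Qed.

Lemma has_meanD X Y m m' :
  has_mean X m -> has_mean Y m' -> has_mean (fun w => X w + Y w) (m + m').
Proof.
move=> [iX X_] [iY Y_]; split; first exact: (integrableD measurableT iX iY).
under eq_integral do rewrite EFinD.
by rewrite integralD// X_ Y_.
Qed.

Lemma has_meanZ c X m : has_mean X m -> has_mean (fun w => c * X w) (c * m).
Proof.
move=> [iX X_]; split; first exact: (integrableZl measurableT _ iX).
by under eq_integral do rewrite EFinM; rewrite integralZl// X_.
Qed.

Lemma has_mean_le X Y m m' :
  has_mean X m -> has_mean Y m' -> (forall w, X w <= Y w) -> m <= m'.
Proof.
move=> [iX X_] [iY Y_] XY; rewrite -lee_fin -X_ -Y_.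
by apply: le_integral => // w _; rewrite lee_fin.
Qed.

Lemma ge0_has_mean X m : measurable_fun setT X -> (forall w, 0 <= X w) ->
  (\int[P]_w (X w)%:E = m%:E)%E -> has_mean X m.
Proof.
move=> mX X0 X_; split => //; apply/integrableP; split.
  exact/measurable_EFinP.
by under eq_integral do rewrite /= ger0_norm//; rewrite X_ ltry.
Qed.

Lemma has_mean_dominated X Y m' : measurable_fun setT X -> has_mean Y m' ->
  (forall w, `|X w| <= Y w) -> exists m, has_mean X m.
Proof.
move=> mX [iY _] XY.
have iX : P.-integrable setT (EFin \o X).
  apply: (le_integrable measurableT _ _ iY); first exact/measurable_EFinP.
  by move=> w _; rewrite /= lee_fin (le_trans (XY w))// ler_norm.
exists (fine (\int[P]_w (X w)%:E)%E); split => //.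
by rewrite fineK//; exact: integrable_fin_num.
Qed.

End has_mean.

(** * Moments of the score and the lower bound on second moments *)

Section location_score.
Context d (Omega : measurableType d) (R : realType) (P : probability Omega R).
Variables (X Y : {RV P >-> R}) (vx vy a b : R).
Hypotheses (vx0 : 0 < vx) (vy0 : 0 < vy).
Hypotheses (gX : gaussian_rv X 0 vx) (gY : gaussian_rv Y 0 vy).
Hypothesis XY : independent_rvs X Y.

Let U w : R := a * X w - b * Y w.
Let v : R := a ^+ 2 * vx + b ^+ 2 * vy.
Let rho t w : R := expR (t * U w - t ^+ 2 * v / 2).

Let v0 : 0 <= v.
Proof. by rewrite addr_ge0// mulr_ge0// ?sqr_ge0// ltW. Qed.

Let mX : measurable_fun setT (X : Omega -> R).
Proof. exact: (measurable_funPT X). Qed.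

Let mY : measurable_fun setT (Y : Omega -> R).
Proof. exact: (measurable_funPT Y). Qed.

Let mU : measurable_fun setT U.
Proof. by apply: measurable_funB; exact: measurable_funM. Qed.

Let mrho t : measurable_fun setT (rho t).
Proof.
apply: measurableT_comp => //; apply: measurable_funB => //.
exact: measurable_funM.
Qed.

(** For the shift [t Cov((X, Y), U) = (t a vx, - t b vy)] the Cameron-Martin exponent collapses to
    [t U - t^2 v / 2]. *)
Let ge0_integral_shift t (f : R * R -> R) :
  measurable_fun setT f -> (forall z, 0 <= f z) ->
  (\int[P]_w (f (X w + t * (a * vx), Y w - t * (b * vy)))%:E =
   \int[P]_w (f (X w, Y w) * rho t w)%:E)%E.
Proof.
move=> mf f0.
rewrite [LHS](ge0_integral_gaussian_pair_shift vx0 vy0 gX gY XY (t * (a * vx))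
  (- (t * (b * vy))) (f := EFin \o f))//; last exact/measurable_EFinP.
apply: eq_integral => w _; rewrite -EFinM; congr (_ * expR _)%:E.
rewrite /U /v; field.
by rewrite !gt_eqF.
Qed.

(** The nonnegative case is applied to [|g|] for integrability, then to the positive and negative
    parts, with which multiplication by [rho t >= 0] commutes. *)
Let has_mean_shift t (g : R * R -> R) m : measurable_fun setT g ->
  has_mean P (fun w => g (X w + t * (a * vx), Y w - t * (b * vy))) m ->
  has_mean P (fun w => g (X w, Y w) * rho t w) m.
Proof.
move=> mg [ig g_].
have rho0 w : 0 <= rho t w by exact: expR_ge0.
have maxM x w : Num.max (x * rho t w) 0 = Num.max x 0 * rho t w.
  by rewrite maxr_pMl// mul0r.
split.
  apply/integrableP; split.
    apply/measurable_EFinP; apply: measurable_funM => //.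
    by apply: (measurableT_comp mg); exact: measurable_fun_pair.
  have /integrableP[_] := ig.
  rewrite (ge0_integral_shift t (f := fun z => `|g z|))//;
    last exact: measurableT_comp.
  by apply: le_lt_trans; rewrite le_eqVlt; apply/orP; left; apply/eqP;
    apply: eq_integral => w _; rewrite /= normrM (ger0_norm (rho0 w)).
rewrite -g_ integralE [RHS]integralE; congr (_ - _)%E.
- under eq_integral do rewrite funeposE -EFin_max maxM.
  rewrite -(ge0_integral_shift t (f := fun z => Num.max (g z) 0)).
  + by apply: eq_integral => w _; rewrite funeposE -EFin_max.
  + exact: measurable_maxr.
  + by move=> z; rewrite le_max lexx orbT.
- under eq_integral do rewrite funenegE -EFinN -EFin_max -mulNr maxM.
  rewrite -(ge0_integral_shift t (f := fun z => Num.max (- g z) 0)).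
  + by apply: eq_integral => w _; rewrite funenegE -EFinN -EFin_max.
  + by apply: measurable_maxr => //; exact: measurableT_comp.
  + by move=> z; rewrite le_max lexx orbT.
Qed.

Let has_mean_rho t : has_mean P (rho t) 1.
Proof.
have := @has_mean_shift t (fun=> 1) 1 (measurable_cst _) (has_mean_cst P 1).
by under eq_fun do rewrite mul1r.
Qed.

Lemma has_mean_exp_score t :
  has_mean P (fun w => expR (t * U w)) (expR (t ^+ 2 * v / 2)).
Proof.
have := has_meanZ (expR (t ^+ 2 * v / 2)) (has_mean_rho t).
rewrite mulr1; under eq_fun do rewrite /rho -expRD addrC subrK.
by [].
Qed.

Let has_mean_cosh t : has_mean P
  (fun w => expR (t * U w) + expR (- (t * U w))) (2 * expR (t ^+ 2 * v / 2)).
Proof.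
have h := has_mean_exp_score (- t); rewrite sqrrN in h.
have := has_meanD (has_mean_exp_score t) h.
by under eq_fun do rewrite mulNr; rewrite -mulr2n mulr_natl.
Qed.

(** For [0 < t <= e] both [t <= 1] and [t^2 v <= 1/2] hold, the latter being the range of
    [expR_le_quadratic]. *)
Let e : R := (2 * (v + 1))^-1.

Let e0 : 0 < e.
Proof. by rewrite invr_gt0; have := v0; lra. Qed.

Let small t : 0 < t -> t <= e -> t ^+ 2 * v <= 1 / 2.
Proof.
move=> t0 te; have v1 := v0.
have h : t * (2 * (v + 1)) <= 1.
  by rewrite -ler_pdivlMr ?mul1r//; lra.
have t1 : t <= 1 by nra.
have h2 : t * v <= 1 / 2 by nra.
have : t * (t * v) <= 1 * (1 / 2) by apply: ler_pM => //; [lra|nra].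
by rewrite mulrA -expr2; lra.
Qed.

(** [cosh_ge] at [U] gives existence of the mean; at [t U] it gives [t^2 M <= 2 (e^(t^2 v / 2) - 1)
    <= t^2 (v + t^2 v^2)]. The reverse inequality is left to the general lower bound. *)
Lemma has_mean_sqr_score : exists2 M, has_mean P (fun w => U w ^+ 2) M & M <= v.
Proof.
have [M hM] : exists M, has_mean P (fun w => U w ^+ 2) M.
  apply: (has_mean_dominated _ (has_mean_cosh 1)); first exact: measurable_funX.
  move=> w; rewrite ger0_norm ?sqr_ge0// mul1r.
  by have := cosh_ge (U w); lra.
exists M => //.
apply: (@ler_lim_linear _ _ _ (v ^+ 2) e) => //; first exact: sqr_ge0.
move=> t t0 te.
have sm := small t0 te.
have x0 : 0 <= t ^+ 2 * v / 2 by rewrite divr_ge0// mulr_ge0// sqr_ge0.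
have hx : t ^+ 2 * v / 2 <= 1 / 2 by lra.
have := has_mean_le (has_meanZ (t ^+ 2) hM)
  (has_meanD (has_mean_cst P (- 2)) (has_mean_cosh t)).
have h w : t ^+ 2 * U w ^+ 2 <= - 2 + (expR (t * U w) + expR (- (t * U w))).
  by have := cosh_ge (t * U w); rewrite exprMn; lra.
move=> /(_ h) {}h.
have ex := expR_le_quadratic x0 hx.
have : t ^+ 2 * M <= t ^+ 2 * (v + t ^+ 2 * v ^+ 2).
  apply: (le_trans h).
  have -> : t ^+ 2 * (v + t ^+ 2 * v ^+ 2) =
     2 * (t ^+ 2 * v / 2 + 2 * (t ^+ 2 * v / 2) ^+ 2) by field.
  lra.
(* After division by [t^2] the error is [t^2 v^2]; [t <= 1] makes it linear in [t]. *)
rewrite ler_pM2l ?exprn_gt0// => /le_trans; apply; rewrite lerD2l mulrC.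
apply: ler_wpM2l; first exact: sqr_ge0.
have t1 : t <= 1.
  by apply: (le_trans te); rewrite invf_le1; have := v0; lra.
nra.
Qed.

(** The mean [m] exists since [|U| <= 1 + U^2]. For [s = 1] and [s = -1], taking means in
    [1 + t s U <= e^(t s U)] yields [s m <= v t], so both [m] and [-m] are at most 0. *)
Lemma has_mean_score : has_mean P U 0.
Proof.
have [M hM _] := has_mean_sqr_score.
have [m hm] : exists m, has_mean P U m.
  apply: (has_mean_dominated mU (has_meanD (has_mean_cst P 1) hM)) => w.
  by rewrite -[U w ^+ 2]real_normK ?num_real//; nra.
have bound s : s ^+ 2 = 1 -> s * m <= 0.
  move=> s1.
  apply: (@ler_lim_linear _ _ _ v e) => //.
  move=> t t0 te; rewrite add0r.
  have sm := small t0 te.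
  have x0 : 0 <= t ^+ 2 * v / 2 by rewrite divr_ge0// mulr_ge0// sqr_ge0.
  have hx : t ^+ 2 * v / 2 <= 1 / 2 by lra.
  have ex := expR_le_quadratic x0 hx.
  have := has_mean_le (has_meanD (has_mean_cst P 1) (has_meanZ (t * s) hm))
     (has_mean_exp_score (t * s)) (fun w => expR_ge1Dx _).
  rewrite exprMn s1 mulr1 => h.
  have : t * (s * m) <= t * (v * t) by nra.
  by rewrite ler_pM2l.
have h1 := bound 1 (expr1n _ _).
have h2 := bound (- 1) (etrans (sqrrN 1) (expr1n _ _)).
by have -> : 0 = m by lra.
Qed.

(** In the application [g] is the error of an unbiased estimator as a function of the noise, and the
    second hypothesis is unbiasedness along a line of parameters. *)
Lemma second_moment_ge (g : R * R -> R) : measurable_fun setT g ->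
  (forall t, has_mean P
    (fun w => g (X w + t * (a * vx), Y w - t * (b * vy))) (t * v)) ->
  (v%:E <= \int[P]_w ((g (X w, Y w)) ^+ 2)%:E)%E.
Proof.
move=> mg hg.
have mgW : measurable_fun setT (fun w => g (X w, Y w)).
  by apply: (measurableT_comp mg); exact: measurable_fun_pair.
have : (0 <= \int[P]_w ((g (X w, Y w)) ^+ 2)%:E)%E.
  by apply: integral_ge0 => w _; rewrite lee_fin sqr_ge0.
(* An infinite second moment satisfies the bound trivially; from here on it is a real number [V]. *)
case E : (\int[P]_w _)%E => [V| |] // _; last by rewrite leey.
rewrite lee_fin.
have hV : has_mean P (fun w => g (X w, Y w) ^+ 2) V.
  apply: ge0_has_mean => //; first exact: measurable_funX.
  by move=> w; exact: sqr_ge0.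
have hg0 : has_mean P (fun w => g (X w, Y w)) 0.
  have := hg 0; rewrite [0 * v]mul0r; congr (has_mean P _ 0).
  by apply/funext => w; rewrite !mul0r subr0 addr0.
apply: (@ler_lim_linear _ _ _ (2 * v ^+ 2) e) => //.
  by rewrite mulr_ge0// sqr_ge0.
move=> t t0 te.
have sm := small t0 te.
have x0 : 0 <= t ^+ 2 * v by rewrite mulr_ge0// sqr_ge0.
have ex := expR_le_quadratic x0 sm.
(* [rho_t^2 = e^(- t^2 v) e^(2 t U)], and the second factor has mean [e^(2 t^2 v)]. *)
have hrho2 : has_mean P (fun w => rho t w ^+ 2) (expR (t ^+ 2 * v)).
  have := has_meanZ (expR (- (t ^+ 2 * v))) (has_mean_exp_score (2 * t)).
  rewrite -expRD; congr (has_mean P _ (expR _)); last by field.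
  by apply/funext => w; rewrite [RHS]expr2 -!expRD; congr expR; field.
have hL := has_meanD (has_meanZ (2 * t^-1) (has_mean_shift mg (hg t)))
                     (has_meanZ (- (2 * t^-1)) hg0).
have hR := has_meanD hV (has_meanZ (t^-1 ^+ 2)
  (has_meanD hrho2
    (has_meanD (has_meanZ (- 2) (has_mean_rho t)) (has_mean_cst P 1)))).
have := has_mean_le hL hR.
have h w : 2 * t^-1 * (g (X w, Y w) * rho t w) + - (2 * t^-1) * g (X w, Y w) <=
   g (X w, Y w) ^+ 2 + t^-1 ^+ 2 * (rho t w ^+ 2 + (- 2 * rho t w + 1)).
  rewrite -subr_ge0.
  set r := rho t w; set y := g _; set c := t^-1.
  have -> : y ^+ 2 + c ^+ 2 * (r ^+ 2 + (- 2 * r + 1)) -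
    (2 * c * (y * r) + - (2 * c) * y) = (y - c * (r - 1)) ^+ 2 by ring.
  exact: sqr_ge0.
move=> /(_ h) {}h.
have t1 : t <= 1.
  by apply: (le_trans te); rewrite invf_le1; have := v0; lra.
(* The quadratic bound on [e^(t^2 v) - 1] turns the right side into [V + v + 2 v^2 t^2]. *)
have : 2 * v <= V + t^-1 ^+ 2 * (t ^+ 2 * v + 2 * (t ^+ 2 * v) ^+ 2).
  have -> : 2 * v = 2 * t^-1 * (t * v) + - (2 * t^-1) * 0.
    by field; rewrite gt_eqF.
  apply: (le_trans h); rewrite lerD2l ler_wpM2l ?sqr_ge0//; lra.
have -> : t^-1 ^+ 2 * (t ^+ 2 * v + 2 * (t ^+ 2 * v) ^+ 2) =
  v + 2 * v ^+ 2 * (t * t).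
  by field; rewrite gt_eqF.
have : 2 * v ^+ 2 * (t * t) <= 2 * v ^+ 2 * t.
  by apply: ler_wpM2l; [rewrite mulr_ge0// sqr_ge0 | nra].
lra.
Qed.

End location_score.

(** * The cost of a split, and its comparison at two points *)

Section split_cost.
Variables (R : realType) (a b : R).
Hypotheses (a0 : 0 < a) (b0 : 0 < b).

Definition split_cost (x y : R) : R := a ^+ 2 / x + b ^+ 2 / y.

Lemma split_cost_sum (x y : R) : 0 < x -> 0 < y ->
  split_cost x y =
  (x + y)^-1 * (a + b) ^+ 2 + (a * y - b * x) ^+ 2 / (x * y * (x + y)).
Proof.
by move=> x0 y0; rewrite /split_cost; field; rewrite !gt_eqF// addr_gt0.
Qed.

(** The factored form reduces each comparison of costs to that of [a^2 (L - x) (L - z)] with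
    [b^2 x z]. *)
Lemma split_costB (L x z : R) : 0 < x -> x < L -> 0 < z -> z < L ->
  split_cost x (L - x) - split_cost z (L - z) =
  (z - x) * (a ^+ 2 * ((L - x) * (L - z)) - b ^+ 2 * (x * z)) /
    (x * z * ((L - x) * (L - z))).
Proof.
move=> x0 xL z0 zL; rewrite /split_cost; field.
by rewrite !gt_eqF// subr_gt0.
Qed.

(** The last hypothesis places [z] at or before the continuous optimum [L a / (a + b)], on whose
    left the cost strictly decreases. *)
Lemma split_cost_lt_left (L x z : R) : 0 < x -> x < z -> z < L ->
  b * z <= a * (L - z) -> split_cost z (L - z) < split_cost x (L - x).
Proof.
move=> x0 xz zL h.
have z0 : 0 < z by lra.
have xL : x < L by lra.
have h' : b * x < a * (L - x).
  apply: (@lt_le_trans _ _ (b * z)); first by rewrite ltr_pM2l.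
  by apply: (le_trans h); rewrite ler_pM2l//; lra.
rewrite -subr_gt0 split_costB// divr_gt0//; last first.
  by rewrite !mulr_gt0// subr_gt0.
rewrite mulr_gt0 ?subr_gt0//.
have -> : b ^+ 2 * (x * z) = (b * x) * (b * z) by ring.
have -> : a ^+ 2 * ((L - x) * (L - z)) = (a * (L - x)) * (a * (L - z)) by ring.
apply: (@lt_le_trans _ _ (a * (L - x) * (b * z))).
  by rewrite ltr_pM2r// mulr_gt0.
by rewrite ler_pM2l// mulr_gt0// subr_gt0.
Qed.

Lemma split_cost_lt_right (L x z : R) : 0 < z -> z < x -> x < L ->
  a * (L - z) <= b * z -> split_cost z (L - z) < split_cost x (L - x).
Proof.
move=> z0 zx xL h.
have x0 : 0 < x by lra.
have zL : z < L by lra.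
have h' : a * (L - x) < b * x.
  apply: (@lt_le_trans _ _ (a * (L - z))); first by rewrite ltr_pM2l//; lra.
  by apply: (le_trans h); rewrite ler_pM2l//; lra.
rewrite -subr_gt0 split_costB// divr_gt0//; last first.
  by rewrite !mulr_gt0// subr_gt0.
rewrite -mulrNN mulr_gt0 ?oppr_gt0 ?subr_lt0//.
have -> : b ^+ 2 * (x * z) = (b * x) * (b * z) by ring.
have -> : a ^+ 2 * ((L - x) * (L - z)) = (a * (L - x)) * (a * (L - z)) by ring.
apply: (@lt_le_trans _ _ (b * x * (a * (L - z)))).
  by rewrite ltr_pM2r// mulr_gt0// subr_gt0.
by rewrite ler_pM2l// mulr_gt0.
Qed.

Lemma split_cost_le (L x z : R) : 0 < x -> x < z -> z < L ->
  (split_cost x (L - x) <= split_cost z (L - z)) =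
    (a ^+ 2 * ((L - x) * (L - z)) <= b ^+ 2 * (x * z)).
Proof.
move=> x0 xz zL.
rewrite -subr_le0 split_costB//; [|lra|lra].
rewrite pmulr_lle0 ?invr_gt0 ?mulr_gt0 ?subr_gt0//; [|lra|lra].
by rewrite pmulr_rle0 ?subr_gt0// subr_le0.
Qed.

Lemma split_cost_ge (L x z : R) : 0 < x -> x < z -> z < L ->
  (split_cost z (L - z) <= split_cost x (L - x)) =
    (b ^+ 2 * (x * z) <= a ^+ 2 * ((L - x) * (L - z))).
Proof.
move=> x0 xz zL.
rewrite -subr_ge0 split_costB//; [|lra|lra].
rewrite pmulr_lge0 ?invr_gt0 ?mulr_gt0 ?subr_gt0//; [|lra|lra].
by rewrite pmulr_rge0 ?subr_gt0// subr_ge0.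
Qed.

(** The distances are [ln r - ln p] and [ln q - ln r], so they compare as [2 ln r] and [ln p + ln q]
    do. *)
Lemma ln_dist_le (p q r : R) : 0 < p -> 0 < r -> 0 < q -> p <= r -> r <= q ->
  (`|ln p - ln r| <= `|ln q - ln r|) = (r ^+ 2 <= p * q) /\
  (`|ln q - ln r| <= `|ln p - ln r|) = (p * q <= r ^+ 2).
Proof.
move=> p0 r0 q0 pr rq.
have lp : ln p <= ln r by rewrite ler_ln.
have lq : ln r <= ln q by rewrite ler_ln.
rewrite ler0_norm ?subr_le0// ger0_norm ?subr_ge0//.
rewrite -[in r ^+ 2 <= _]ler_ln ?posrE ?mulr_gt0 ?exprn_gt0//.
rewrite -[in _ <= r ^+ 2]ler_ln ?posrE ?mulr_gt0 ?exprn_gt0//.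
rewrite expr2 !lnM ?posrE//.
by split; apply/idP/idP; lra.
Qed.

(** The last two hypotheses say that [x] and [z] bracket the continuous optimum, so [a / b] lies
    between the two ratios and [ln_dist_le] applies. *)
Lemma split_cost_ln_dist (L x z : R) : 0 < x -> x < z -> z < L ->
  b * x <= a * (L - x) -> a * (L - z) <= b * z ->
  (split_cost x (L - x) <= split_cost z (L - z)) =
    (`|ln (x / (L - x)) - ln (a / b)| <= `|ln (z / (L - z)) - ln (a / b)|) /\
  (split_cost z (L - z) <= split_cost x (L - x)) =
    (`|ln (z / (L - z)) - ln (a / b)| <= `|ln (x / (L - x)) - ln (a / b)|).
Proof.
move=> x0 xz zL hx hz.
have [xL z0] : x < L /\ 0 < z by split; lra.
have ex : L - x != 0 by rewrite gt_eqF// subr_gt0.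
have ez : L - z != 0 by rewrite gt_eqF// subr_gt0.
have D0 : 0 < b ^+ 2 * ((L - x) * (L - z)).
  by rewrite !mulr_gt0 ?exprn_gt0 ?subr_gt0.
have e1 : (a / b) ^+ 2 =
    a ^+ 2 * ((L - x) * (L - z)) / (b ^+ 2 * ((L - x) * (L - z))).
  by field; rewrite ex ez gt_eqF.
have e2 : x / (L - x) * (z / (L - z)) =
    b ^+ 2 * (x * z) / (b ^+ 2 * ((L - x) * (L - z))).
  by field; rewrite ex ez gt_eqF.
have [] := @ln_dist_le (x / (L - x)) (z / (L - z)) (a / b).
- by rewrite divr_gt0// subr_gt0.
- by rewrite divr_gt0.
- by rewrite divr_gt0// subr_gt0.
- by rewrite ler_pdivrMr ?subr_gt0// mulrAC ler_pdivlMr// mulrC.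
- by rewrite ler_pdivrMr// mulrAC ler_pdivlMr ?subr_gt0// [z * b]mulrC.
move=> -> ->; rewrite e1 e2 !ler_pM2r ?invr_gt0//.
by rewrite split_cost_le// split_cost_ge.
Qed.

End split_cost.

(** * Rounding into the feasible integer range *)

(** The two candidates are equal or consecutive. Where one fails to lie on its side of [x], it is an
    endpoint of the feasible range, with no feasible count beyond it. *)
Lemma feasible_rounding_bounds (R : realType) (L : nat) (x : R) :
  (2 <= L)%N -> 0 < x -> x < L%:R ->
  let k0 := maxn 1 (Num.truncn x) in let k1 := minn L.-1 `|Num.ceil x|%N in
  [/\ ((1 <= k0 < L) && (1 <= k1 < L))%N, (k0 <= k1 <= k0.+1)%N,
      (k0 = 1%N \/ k0%:R <= x), (k1 = L.-1 \/ x <= k1%:R) &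
      ((k0 < k1)%N -> k0%:R <= x <= k1%:R)].
Proof.
move=> L2 x0 xL.
have /andP[m1 m2] := truncn_itv (ltW x0).
have c0 : (0 < Num.ceil x) by rewrite ceil_gt0.
have cE : (`|Num.ceil x|%N)%:R = (Num.ceil x)%:~R :> R.
  by rewrite -[in RHS](gtz0_abs c0).
have c1 : x <= (`|Num.ceil x|%N)%:R by rewrite cE ceil_ge.
have c2 : (`|Num.ceil x|%N)%:R < x + 1.
  by rewrite cE; have := ceilB1_lt x; rewrite intrB; lra.
set m := Num.truncn x in m1 m2 *; set c := `|Num.ceil x|%N in c1 c2 *.
have mL : (m < L)%N by rewrite -(ltr_nat R); exact: le_lt_trans xL.
have mc : (m <= c)%N by rewrite -(ler_nat R); exact: le_trans c1.
have cm : (c < m.+2)%N by rewrite -(ltr_nat R) -[m.+2]addn1 natrD; lra.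
have c_gt0 : (0 < c)%N by rewrite absz_gt0 gt_eqF.
move=> k0 k1; split; rewrite /k0 /k1.
- lia.
- lia.
- case: (boolP (m <= 1)%N) => m0; [left; lia | right].
  by have -> : maxn 1 m = m by lia.
- case: (boolP (L.-1 <= c)%N) => cL; [left; lia | right].
  by have -> : minn L.-1 c = c by lia.
(* A clamp that changed a value would force [k0 = k1], so these are the plain floor and ceiling. *)
move=> k01; have -> : maxn 1 m = m by lia.
have -> : minn L.-1 c = c by lia.
by rewrite m1.
Qed.

(** * Optimal continuous and integer splits *)

Section splits.
Variables (R : realType) (n : nat) (s_in s_out : R).
Hypotheses (n0 : (1 <= n)%N) (s_in0 : 0 < s_in) (s_out0 : 0 < s_out).

Let a : R := n.+1%:R * s_in.
Let b : R := n%:R * s_out.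

Let a0 : 0 < a. Proof. by rewrite mulr_gt0// ltr0n. Qed.
Let b0 : 0 < b. Proof. by rewrite mulr_gt0// ltr0n. Qed.

Let mse_starE x y : mse_star n s_in s_out x y = split_cost a b x y.
Proof. by rewrite /mse_star /split_cost !exprMn. Qed.

Let ratio_starE : ratio_star n s_in s_out = a / b.
Proof.
rewrite /ratio_star /a /b; field.
by rewrite [n%:R == _]gt_eqF ?ltr0n// gt_eqF.
Qed.

Let ab0 : 0 < a + b. Proof. by rewrite addr_gt0. Qed.

Let star_feasible (L : R) : 0 < L ->
  feasible_split L (L * a / (a + b)) (L * b / (a + b)).
Proof.
move=> L0; split; first exact: (divr_gt0 (mulr_gt0 L0 a0) ab0).
  exact: (divr_gt0 (mulr_gt0 L0 b0) ab0).
by rewrite -mulrDl -mulrDr mulfK// gt_eqF.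
Qed.

Let star_cost (L : R) : 0 < L ->
  split_cost a b (L * a / (a + b)) (L * b / (a + b)) = L^-1 * (a + b) ^+ 2.
Proof.
move=> L0; rewrite /split_cost; move: a0 b0 ab0.
move: (a) (b) => p q p0 q0 pq0; field.
by rewrite !gt_eqF.
Qed.

Lemma optimal_split_exists (L : R) : 0 < L ->
  exists Lin Lout, optimal_split n s_in s_out L Lin Lout.
Proof.
move=> L0.
exists (L * a / (a + b)), (L * b / (a + b)); split; first exact: star_feasible.
move=> x y [x0 y0 xy]; rewrite !mse_starE.
rewrite (split_cost_sum a b x0 y0) xy star_cost//.
by rewrite lerDl divr_ge0 ?sqr_ge0// !mulr_ge0// ltW.
Qed.

(** Comparison with the explicit split in proportion [a : b] forces the square in [split_cost_sum]
    to vanish, that is [a Lout = b Lin]. *)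
Lemma optimal_splitP (L Lin Lout : R) : 0 < L ->
  optimal_split n s_in s_out L Lin Lout ->
  Lin / Lout = n.+1%:R / n%:R * (s_in / s_out) /\
  mse_star n s_in s_out Lin Lout
    = L^-1 * (n.+1%:R * s_in + n%:R * s_out) ^+ 2.
Proof.
move=> L0 [[x0 y0 xy] opt].
have := opt _ _ (star_feasible L0); rewrite !mse_starE.
rewrite (split_cost_sum a b x0 y0) xy star_cost//.
rewrite gerDl pmulr_lle0 ?invr_gt0 ?mulr_gt0// => h.
have {}h : a * Lout - b * Lin = 0.
  by apply/eqP; rewrite -sqrf_eq0 eq_le h sqr_ge0.
rewrite h expr0n mul0r addr0; split => //.
rewrite -/(ratio_star n s_in s_out) ratio_starE.
by apply/eqP; rewrite eqr_div ?lt0r_neq0// mulrC eq_sym -subr_eq0 h.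
Qed.

(** Counts below [k0] cost strictly more than [k0], and counts above [k1] strictly more than [k1].
    Between the two roundings, the order of costs is the order of log-ratio distances. *)
Lemma optimal_isplitP (L kin kout : nat) : (2 <= L)%N ->
  optimal_isplit n s_in s_out L kin kout <->
  nearest_feasible_rounding n s_in s_out L kin kout.
Proof.
move=> L2.
have L0 : 0 < L%:R :> R by rewrite ltr0n; lia.
set x := Lin_star n s_in s_out L.
have xE : x = L%:R * a / (a + b).
  by rewrite /x /Lin_star ratio_starE; field; rewrite !gt_eqF.
have x0 : 0 < x by rewrite xE divr_gt0// mulr_gt0.
have xL : x < L%:R by rewrite xE ltr_pdivrMr// ltr_pM2l// ltrDl.
have le_x (z : R) : z <= x -> b * z <= a * (L%:R - z).
  by rewrite xE ler_pdivlMr// mulrDr mulrBr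
    [z * a]mulrC [z * b]mulrC [L%:R * a]mulrC lerBrDl.
have ge_x (z : R) : x <= z -> a * (L%:R - z) <= b * z.
  by rewrite xE ler_pdivrMr// mulrDr mulrBr
    [z * a]mulrC [z * b]mulrC [L%:R * a]mulrC lerBlDl.
pose f k := split_cost a b k%:R (L%:R - k%:R).
pose D k := `|ln (k%:R / (L%:R - k%:R)) - ln (a / b)|.
have cE k l : (k + l = L)%N -> l%:R = L%:R - k%:R :> R.
  by move=> <-; rewrite natrD addrC addKr.
have [] := @feasible_rounding_bounds R L x L2 x0 xL.
set k0 := maxn 1 _; set k1 := minn L.-1 _.
move=> /andP[/andP[k0_gt0 k0L] /andP[k1_gt0 k1L]] /andP[k01 k10] hk0 hk1 hk.
have roundE k l : feasible_rounding n s_in s_out L k l <->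
    feasible_isplit L k l /\ (k = k0 \/ k = k1) by [].
clearbody k0 k1.
have between k : (k0 <= k)%N -> (k <= k1)%N -> k = k0 \/ k = k1.
  by move=> k0k kk1; clear -k10 k0k kk1; lia.
have feas_lt k l : feasible_isplit L k l -> (0 < k)%N /\ (k < L)%N.
  by move=> [k_gt0 l_gt0 <-]; split=> //; rewrite -[ltnLHS]addn0 ltn_add2l.
(* Either [k0 = 1] and no such [k] exists, or [k0] is at most the continuous optimum. *)
have left_lt k : (0 < k)%N -> (k < k0)%N -> f k0 < f k.
  move=> kgt0 kk0; apply: split_cost_lt_left => //; rewrite ?ltr0n ?ltr_nat//.
  by apply: le_x; case: hk0 => // hk0; clear -kgt0 kk0 hk0; lia.
have right_lt k : (k < L)%N -> (k1 < k)%N -> f k1 < f k.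
  move=> kL kk1; apply: split_cost_lt_right => //; rewrite ?ltr0n ?ltr_nat//.
  by apply: ge_x; case: hk1 => // hk1; clear -kL kk1 hk1; lia.
have cmp k k' : k = k0 \/ k = k1 -> k' = k0 \/ k' = k1 ->
    (f k <= f k') = (D k <= D k').
  have [e01|n01] := eqVneq k0 k1.
    by rewrite -e01 => -[]-> []->; rewrite !lexx.
  have lt01 : (k0 < k1)%N by rewrite ltn_neqAle n01.
  have /andP[h0 h1] := hk lt01.
  have [A B] : (f k0 <= f k1) = (D k0 <= D k1) /\
      (f k1 <= f k0) = (D k1 <= D k0).
    apply: split_cost_ln_dist => //; rewrite ?ltr0n ?ltr_nat//.
    - exact: le_x.
    - exact: ge_x.
  by move=> []-> []->; rewrite ?lexx.
have feas k : (0 < k)%N -> (k < L)%N -> feasible_isplit L k (L - k).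
  by move=> k_gt0 kL; split; rewrite ?subn_gt0// subnKC// ltnW.
have fE k l : feasible_isplit L k l ->
    mse_star n s_in s_out k%:R l%:R = f k.
  by move=> [_ _ /cE ->]; rewrite mse_starE.
have DE k l : feasible_isplit L k l -> ratio_dist n s_in s_out k l = D k.
  by move=> [_ _ /cE e]; rewrite /ratio_dist ratio_starE e.
split=> [[fk opt] | [/roundE[fk kk] near]].
  have [k_gt0 kL] := feas_lt _ _ fk.
  have o0 := opt _ _ (feas _ k0_gt0 k0L).
  have o1 := opt _ _ (feas _ k1_gt0 k1L).
  rewrite !fE// in o0 o1; last 2 first.
  - exact: feas.
  - exact: feas.
  have kk : kin = k0 \/ kin = k1.
    have [lt0|ge0] := ltnP kin k0.
      have : f k0 < f kin by exact: left_lt.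
      by rewrite ltNge o0.
    have [lt1|ge1] := ltnP k1 kin.
      have : f k1 < f kin by exact: right_lt.
      by rewrite ltNge o1.
    exact: between.
  split; first by apply/roundE.
  move=> k' l' /roundE[fk' kk']; rewrite !DE// -(cmp _ _ kk kk').
  by have := opt _ _ fk'; rewrite !fE.
split=> // k' l' fk'; rewrite !fE//.
have [k'_gt0 k'L] := feas_lt _ _ fk'.
have near0 : f kin <= f k0.
  have h : feasible_rounding n s_in s_out L k0 (L - k0).
    by apply/roundE; split; [exact: feas | left].
  rewrite (cmp _ _ kk (or_introl erefl)).
  by have := near _ _ h; rewrite !DE//; exact: feas.
have near1 : f kin <= f k1.
  have h : feasible_rounding n s_in s_out L k1 (L - k1).
    by apply/roundE; split; [exact: feas | right].
  rewrite (cmp _ _ kk (or_intror erefl)).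
  by have := near _ _ h; rewrite !DE//; exact: feas.
have [lt0|ge0] := ltnP k' k0.
  by apply: (le_trans near0); apply/ltW/left_lt.
have [lt1|ge1] := ltnP k1 k'.
  by apply: (le_trans near1); apply/ltW/right_lt.
by have [->|->] := between k' ge0 ge1.
Qed.

End splits.

(** * Unbiased estimation of the target *)

Section estimation.
Context d (Omega : measurableType d) (R : realType) (P : probability Omega R).
Variables (n : nat) (s_in s_out lin lout : R) (win wout : {RV P >-> R}).
Hypotheses (n0 : (1 <= n)%N) (s_in0 : 0 < s_in) (s_out0 : 0 < s_out).
Hypotheses (lin0 : 0 < lin) (lout0 : 0 < lout).
Hypotheses (g_in : gaussian_rv win 0 (s_in ^+ 2 / lin))
           (g_out : gaussian_rv wout 0 (s_out ^+ 2 / lout)).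
Hypothesis indep : independent_rvs win wout.

Let Y := observations n win wout.
Let v := mse_star n s_in s_out lin lout.

Let v_in0 : 0 < s_in ^+ 2 / lin. Proof. by rewrite divr_gt0 ?exprn_gt0. Qed.
Let v_out0 : 0 < s_out ^+ 2 / lout. Proof. by rewrite divr_gt0 ?exprn_gt0. Qed.

Let nz : n%:R != 0 :> R. Proof. by rewrite pnatr_eq0; lia. Qed.
Let n1z : n.+1%:R != 0 :> R. Proof. by rewrite pnatr_eq0. Qed.

Let vE : v = n.+1%:R ^+ 2 * (s_in ^+ 2 / lin) + n%:R ^+ 2 * (s_out ^+ 2 / lout).
Proof. by rewrite /v /mse_star !mulrA. Qed.

(** With noise variances [vin] and [vout], lowering [theta2] by [t n^2 vout] and raising [theta1] by
    [t v] moves the two means by [t (n+1) vin] and [- t n vout], exactly the shift in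
    [second_moment_ge]. *)
Lemma mse_unbiased_ge (T : R * R -> R) theta :
  unbiased P Y T -> (v%:E <= mse P Y T theta)%E.
Proof.
move=> [mT uT].
pose c1 : R := n.+1%:R^-1 * (theta.1 + theta.2).
pose c2 : R := n%:R^-1 * theta.2.
pose g (z : R * R) : R := T (c1 + z.1, c2 + z.2) - theta.1.
have mg : measurable_fun setT g.
  apply: measurable_funB => //; apply: (measurableT_comp mT).
  by apply: measurable_fun_pair; apply: measurable_funD.
have := second_moment_ge v_in0 v_out0 g_in g_out indep
  (a := n.+1%:R) (b := n%:R) mg.
rewrite -vE => h.
rewrite /mse unlock; apply: h => t.
(* [theta'] turns the noise shift of [second_moment_ge] into a change of
   parameter. *)
pose theta' : R * R :=
  (theta.1 + t * v, theta.2 - t * (n%:R ^+ 2 * (s_out ^+ 2 / lout))).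
have [iT eT] := uT theta'.
have hT : has_mean P (T \o Y theta') theta'.1.
  by split => //; rewrite -eT unlock.
have := has_meanD hT (has_mean_cst P (- theta.1)).
rewrite /= [theta.1 + _]addrC addrK; congr (has_mean P _ _).
apply/funext => w; rewrite /g /Y /observations /c1 /c2 /theta' vE /=.
congr (T (_, _) - _); field.
- by rewrite (gt_eqF lin0) (gt_eqF lout0) nat1r n1z.
- by rewrite (gt_eqF lout0) nz.
Qed.

(** The nuisance [theta2] cancels, so the error is the score with [a = n + 1] and [b = n]. *)
Let x_hatE theta w :
  x_hat n (Y theta w) = theta.1 + (n.+1%:R * win w - n%:R * wout w).
Proof.
by rewrite /x_hat /Y /observations /=; field; rewrite nat1r n1z nz.
Qed.

Lemma x_hat_unbiased : unbiased P Y (x_hat n).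
Proof.
split.
  by apply: measurable_funB; apply: measurable_funM.
move=> theta.
have := has_meanD (has_mean_cst P theta.1)
  (has_mean_score n.+1%:R n%:R v_in0 v_out0 g_in g_out indep).
rewrite addr0; under eq_fun do rewrite -x_hatE.
by move=> [? ?]; split => //; rewrite unlock.
Qed.

(** [x_hat] is itself unbiased, so the general lower bound applies to it; [M <= v] gives the other
    inequality. *)
Lemma mse_x_hat theta : mse P Y (x_hat n) theta = v%:E.
Proof.
apply/eqP; rewrite eq_le (mse_unbiased_ge _ x_hat_unbiased) andbT.
have [M [_ hM] Mv] :=
  has_mean_sqr_score n.+1%:R n%:R v_in0 v_out0 g_in g_out indep.
rewrite vE; apply: le_trans (_ : (M%:E <= _)%E); last by rewrite lee_fin.
rewrite /mse unlock -hM le_eqVlt; apply/orP; left; apply/eqP.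
by apply: eq_integral => w _; rewrite x_hatE addrC addKr.
Qed.

End estimation.

Theorem proposition1 (R : realType) (n : nat) (s_in s_out : R)
    (hn : (1 <= n)%N) (hs_in : 0 < s_in) (hs_out : 0 < s_out) :
  (forall (Lin Lout : nat), (1 <= Lin)%N -> (1 <= Lout)%N ->
   forall (d : measure_display) (Omega : measurableType d)
     (P : probability Omega R) (win wout : {RV P >-> R}),
     gaussian_rv win 0 (s_in ^+ 2 / Lin%:R) ->
     gaussian_rv wout 0 (s_out ^+ 2 / Lout%:R) ->
     independent_rvs win wout ->
     let Y := observations n win wout in
     let v := mse_star n s_in s_out Lin%:R Lout%:R in
     [/\ forall theta : R * R, is_minimum_mse P Y theta v%:E,
         best_linear_unbiased P Y (x_hat n) &
         forall theta : R * R, mse P Y (x_hat n) theta = v%:E])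
  /\
  (forall L : R, 0 < L ->
     (exists Lin Lout : R, optimal_split n s_in s_out L Lin Lout) /\
     (forall Lin Lout : R, optimal_split n s_in s_out L Lin Lout ->
        Lin / Lout = n.+1%:R / n%:R * (s_in / s_out) /\
        mse_star n s_in s_out Lin Lout
          = L^-1 * (n.+1%:R * s_in + n%:R * s_out) ^+ 2))
  /\
  (forall L : nat, (2 <= L)%N -> forall kin kout : nat,
     optimal_isplit n s_in s_out L kin kout <->
     nearest_feasible_rounding n s_in s_out L kin kout).
Proof.
split; [|split].
- move=> Lin Lout Lin0 Lout0 d Omega P win wout g_in g_out indep Y v.
  have l0 : 0 < Lin%:R :> R by rewrite ltr0n.
  have l1 : 0 < Lout%:R :> R by rewrite ltr0n.
  have ge := mse_unbiased_ge hn hs_in hs_out l0 l1 g_in g_out indep.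
  have ub := x_hat_unbiased hn hs_in hs_out l0 l1 g_in g_out indep.
  have eq := mse_x_hat hn hs_in hs_out l0 l1 g_in g_out indep.
  split => //.
  + move=> theta; split; first by exists (x_hat n).
    by move=> T uT; exact: ge.
  + split => //; first by exists n.+1%:R, (- n%:R) => y; rewrite mulNr.
    (* Optimality among linear estimators follows from optimality among all unbiased ones. *)
    by move=> T _ uT theta; rewrite eq; exact: ge.
- move=> L L0; split; first exact: optimal_split_exists.
  by move=> Lin Lout; exact: optimal_splitP.
- by move=> L L2 kin kout; exact: optimal_isplitP.
Qed.
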